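(* Let $\beta\in[0,1)$ and $\gamma\in[\beta,1)$. Let $\mathcal{X}\subset\mathbb{R}^n$ be a nonempty convex compact set such that $\|x-y\|\le R$ for all $x,y\in\mathcal{X}$, where $R>0$. For $t\in\{1,\dots,T\}$ let $f_t,r_t:\mathcal{X}\to\mathbb{R}$ be closed convex functions (not necessarily differentiable), let $F_t=f_t+r_t$, and suppose that $\|\tilde\nabla F_t(x)\|\le M$ for all $x\in\mathcal{X}$ and all $t$, where $M>0$. Let $u_1,\dots,u_T\in\mathcal{X}$ be any comparator sequence, and let $x_1,\dots,x_T\in\mathcal{X}$ be generated by the online proximal gradient (OPG) algorithm from an initial point $x_1\in\mathcal{X}$ with the non-increasing step sizes $\eta_t=t^{-\gamma}\sigma$, where $\sigma$ is the constant $$\sigma=\frac{\sqrt{(1-\gamma)\,2R\,T^{2\gamma-\beta-1}D_\beta(T)+R^2T^{2\gamma-1}}}{M}.$$ Then the dynamic regret satisfies $$\mathbf{Reg}_T^d=\mathcal{O}\left(\sqrt{T^{1-\beta}D_\beta(T)+T}\right).$$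
   Context: $\|\cdot\|$ is the Euclidean norm and $\langle\cdot,\cdot\rangle$ the Euclidean inner product on $\mathbb{R}^n$. For a convex function $g:\mathcal{X}\to\mathbb{R}$, $\partial g(x)$ is the subdifferential of $g$ at $x$, i.e. the set of $v$ with $g(y)\ge g(x)+\langle v,y-x\rangle$ for all $y\in\mathcal{X}$, and $\tilde\nabla g(x)$ denotes a subgradient in $\partial g(x)$. Here $\tilde\nabla F_t(x)=\tilde\nabla f_t(x)+\tilde\nabla r_t(x)$, where $\tilde\nabla f_t(x)\in\partial f_t(x)$ is the subgradient used by the algorithm and $\tilde\nabla r_t(x)\in\partial r_t(x)$. OPG algorithm: given $x_1\in\mathcal{X}$ and step sizes $\eta_t>0$, for $t=1,2,\dots$ set $$x_{t+1}=\arg\min_{x\in\mathcal{X}}\left\{r_t(x)+\langle x,\tilde\nabla f_t(x_t)\rangle+\frac{1}{2\eta_t}\|x-x_t\|^2\right\}.$$ Dynamic regret with respect to the comparators $\{u_t\}_{t=1}^T$: $\mathbf{Reg}_T^d:=\sum_{t=1}^TF_t(x_t)-\sum_{t=1}^TF_t(u_t)$. Extended path variation: $D_\beta(T):=\sum_{t=2}^Tt^\beta\|u_t-u_{t-1}\|$. The $\mathcal{O}(\cdot)$ is with respect to the horizon $T$: the hidden constant may depend on $R,M,\beta,\gamma$, but not on $T$, the functions $f_t,r_t$, the comparators $u_t$, or the iterates. *)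

(* Defs.v *)
(* MathComp / MathComp-Analysis *)
From HB Require Import structures.
From mathcomp Require Import all_boot all_order all_algebra.
From mathcomp Require Import all_classical all_reals all_analysis.

Set Implicit Arguments.
Unset Strict Implicit.
Unset Printing Implicit Defensive.

Import Order.TTheory GRing.Theory Num.Theory.
Import numFieldNormedType.Exports.

Local Open Scope classical_set_scope.
Local Open Scope ring_scope.

(* The library norm `|v| on 'rV[K]_n is the sup norm, hence the Euclidean
   structure below. Both induce the same topology, so the library's [compact]
   and [closed] on 'rV[K]_n are the Euclidean ones. *)
Definition dot (K : realType) (n : nat) (v w : 'rV[K]_n) : K :=
  \sum_(i < n) v 0 i * w 0 i.

Definition enorm (K : realType) (n : nat) (v : 'rV[K]_n) : K :=
  Num.sqrt (dot v v).

(* A function g : X -> K is represented by a total function on 'rV[K]_n;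
   the definitions below only look at its values on X. *)
Definition epigraph (K : realType) (n : nat) (X : set 'rV[K]_n)
    (g : 'rV[K]_n -> K) : set ('rV[K]_n * K^o) :=
  [set p | X p.1 /\ g p.1 <= p.2].

Definition closed_convex_function (K : realType) (n : nat) (X : set 'rV[K]_n)
    (g : 'rV[K]_n -> K) : Prop :=
  convex_function X g /\ closed (epigraph X g).

Definition subdifferential (K : realType) (n : nat) (X : set 'rV[K]_n)
    (g : 'rV[K]_n -> K) (x : 'rV[K]_n) : set 'rV[K]_n :=
  [set v | forall y, X y -> g x + dot v (y - x) <= g y].

Definition argmin (K : realType) (n : nat) (X : set 'rV[K]_n)
    (g : 'rV[K]_n -> K) : set 'rV[K]_n :=
  [set x | X x /\ forall y, X y -> g x <= g y].

(* Sequences are indexed by nat, and only the indices 1, ..., T are relevant. *)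

(* [gf t y] is the subgradient of f_t at y used by the algorithm. The OPG
   objective is strongly convex in y, so its argmin is at most a singleton. *)
Definition OPG_iterates (K : realType) (n T : nat) (X : set 'rV[K]_n)
    (r : nat -> 'rV[K]_n -> K) (gf : nat -> 'rV[K]_n -> 'rV[K]_n)
    (eta : nat -> K) (x : nat -> 'rV[K]_n) : Prop :=
  X (x 1%N) /\
  forall t : nat, (1 <= t < T)%N ->
    argmin X (fun y => r t y + dot y (gf t (x t))
                       + (2 * eta t)^-1 * enorm (y - x t) ^+ 2) (x t.+1).

Definition dynamic_regret (K : realType) (n T : nat)
    (F : nat -> 'rV[K]_n -> K) (x u : nat -> 'rV[K]_n) : K :=
  \sum_(1 <= t < T.+1) F t (x t) - \sum_(1 <= t < T.+1) F t (u t).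

Definition path_variation (K : realType) (n : nat) (beta : K) (T : nat)
    (u : nat -> 'rV[K]_n) : K :=
  \sum_(2 <= t < T.+1) t%:R `^ beta * enorm (u t - u t.-1).

Definition OPG_sigma (K : realType) (R M beta gamma : K) (T : nat) (D : K) : K :=
  Num.sqrt ((1 - gamma) * (2 * R) * T%:R `^ (2 * gamma - beta - 1) * D
            + R ^+ 2 * T%:R `^ (2 * gamma - 1)) / M.

(* Main.v *)
(* One step of the algorithm costs at most
     eta_t M^2 / 2 + (|u_t - x_t|^2 - |u_t - x_(t+1)|^2) / (2 eta_t),
   by strong convexity of the proximal objective together with the subgradient
   inequalities at x_t. Replacing u_(t+1) by u_t in |u_(t+1) - x_(t+1)|^2 costs
   2 R |u_(t+1) - u_t|, so the sum telescopes to
     M^2 / 2 * sum eta_t + R^2 / (2 eta_T) + R * sum |u_t - u_(t-1)| / eta_t.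
   Since 1 / eta_t = t^(gamma - beta) t^beta / sigma <= T^(gamma - beta) t^beta
   / sigma, the last sum is controlled by the path variation, and sigma balances
   the three terms. *)
Require Import Defs.
From HB Require Import structures.
From mathcomp Require Import all_boot all_order all_algebra.
From mathcomp Require Import all_classical all_reals all_analysis.
From mathcomp Require Import ring lra.

Set Implicit Arguments.
Unset Strict Implicit.
Unset Printing Implicit Defensive.

Import Order.TTheory GRing.Theory Num.Theory.
Import numFieldNormedType.Exports.

Local Open Scope classical_set_scope.
Local Open Scope ring_scope.

(** * Euclidean inner product and norm *)

Section euclidean.
Context (K : realType) (n : nat).
Implicit Types (v w z : 'rV[K]_n) (a : K).

Lemma dotC v w : dot v w = dot w v.
Proof. by apply: eq_bigr => i _; rewrite mulrC. Qed.

Lemma dotDl v w z : dot (v + w) z = dot v z + dot w z.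
Proof. by rewrite -big_split; apply: eq_bigr => i _; rewrite mxE mulrDl. Qed.

Lemma dotZl a v w : dot (a *: v) w = a * dot v w.
Proof. by rewrite /dot mulr_sumr; apply: eq_bigr => i _; rewrite mxE mulrA. Qed.

Lemma dotNl v w : dot (- v) w = - dot v w.
Proof. by rewrite -scaleN1r dotZl mulN1r. Qed.

Lemma dotDr v w z : dot z (v + w) = dot z v + dot z w.
Proof. by rewrite dotC dotDl !(dotC z). Qed.

Lemma dotZr a v w : dot v (a *: w) = a * dot v w.
Proof. by rewrite dotC dotZl (dotC v). Qed.

Lemma dotNr v w : dot v (- w) = - dot v w.
Proof. by rewrite dotC dotNl (dotC v). Qed.

Definition dotE := (dotDl, dotDr, dotZl, dotZr, dotNl, dotNr).

Lemma dot_ge0 v : 0 <= dot v v.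
Proof. by apply: sumr_ge0 => i _; rewrite -expr2 sqr_ge0. Qed.

Lemma enorm_ge0 v : 0 <= enorm v.
Proof. exact: sqrtr_ge0. Qed.

Lemma sqr_enorm v : enorm v ^+ 2 = dot v v.
Proof. by rewrite sqr_sqrtr// dot_ge0. Qed.

Lemma enorm_le_dot v a : enorm v <= a -> dot v v <= a ^+ 2.
Proof.
by move=> va; rewrite -sqr_enorm ler_sqr ?nnegrE ?enorm_ge0// (le_trans _ va)// enorm_ge0.
Qed.

Lemma enormN v : enorm (- v) = enorm v.
Proof. by rewrite /enorm !dotE opprK. Qed.

Lemma dot_eq0 v w : dot v v = 0 -> dot v w = 0.
Proof.
move=> vv0; apply: big1 => i _.
have sq0 j : true -> 0 <= v 0 j * v 0 j by rewrite -expr2 sqr_ge0.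
have /eqP := psumr_eq0P sq0 vv0 (erefl : true) (i := i).
by rewrite mulf_eq0 orbb => /eqP->; rewrite mul0r.
Qed.

Lemma cauchy_schwarz v w : dot v w <= enorm v * enorm w.
Proof.
have := enorm_ge0 v; rewrite le_eqVlt => /predU1P[v0|v0].
  rewrite -v0 mul0r dot_eq0// -sqr_enorm -v0 expr0n//.
have := enorm_ge0 w; rewrite le_eqVlt => /predU1P[w0|w0].
  by rewrite -w0 mulr0 dotC dot_eq0// -sqr_enorm -w0 expr0n.
(* The square expands to 2 |v| |w| (|v| |w| - <v, w>), whose positive factor then cancels. *)
have := dot_ge0 (enorm w *: v - enorm v *: w).
rewrite !dotE -!sqr_enorm (dotC w v) => h.
rewrite -subr_ge0 -(pmulr_rge0 _ (mulr_gt0 v0 w0)); nra.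
Qed.

(** The difference of squares is the inner product of [u - u'] with [(u - x) + (u' - x)], and
    Cauchy-Schwarz bounds each half. This is the price of a moving comparator. *)
Lemma sqr_enormB_le (S : K) (u u' x : 'rV[K]_n) :
  enorm (u - x) <= S -> enorm (u' - x) <= S ->
  enorm (u - x) ^+ 2 <= enorm (u' - x) ^+ 2 + 2 * S * enorm (u - u').
Proof.
move=> uS u'S; rewrite !sqr_enorm.
have d0 := enorm_ge0 (u - u').
have h1 : dot (u - u') (u - x) <= enorm (u - u') * S.
  by rewrite (le_trans (cauchy_schwarz _ _))// ler_wpM2l.
have h2 : dot (u - u') (u' - x) <= enorm (u - u') * S.
  by rewrite (le_trans (cauchy_schwarz _ _))// ler_wpM2l.
move: h1 h2; rewrite !dotE (dotC u' u) (dotC x u) (dotC x u'); lra.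
Qed.

(** * Inequalities for one round of the algorithm *)

Lemma dot_le_prox (G e : K) v w : 0 < e -> enorm v <= G ->
  dot v w <= e / 2 * G ^+ 2 + (2 * e)^-1 * enorm w ^+ 2.
Proof.
move=> e0 /enorm_le_dot vG; rewrite sqr_enorm.
(* Young's inequality: |e v - w|^2 >= 0, divided by 2 e. *)
have := dot_ge0 (e *: v - w); rewrite !dotE (dotC w v) => h.
rewrite -(ler_pM2l e0).
have -> : e * (e / 2 * G ^+ 2 + (2 * e)^-1 * dot w w) =
   2^-1 * (e * e * G ^+ 2 + dot w w) by field; rewrite gt_eqF.
have : e * e * dot v v <= e * e * G ^+ 2 by rewrite ler_wpM2l// mulr_ge0// ltW.
lra.
Qed.

(* Comparing the minimizer with the points [p + l (u - p)] and letting [l] tend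
   to 0 gives the optimality condition in the direction of [u]. *)
Lemma argmin_prox (X : set 'rV[K]_n) (r : 'rV[K]_n -> K) (c : K)
    (g a p u : 'rV[K]_n) :
  convex_set X -> convex_function X r -> 0 <= c ->
  argmin X (fun y => r y + dot y g + c * enorm (y - a) ^+ 2) p -> X u ->
  r p + dot p g + c * enorm (p - a) ^+ 2 + c * enorm (u - p) ^+ 2
    <= r u + dot u g + c * enorm (u - a) ^+ 2.
Proof.
move=> cX cr c0 [Xp pmin] Xu; rewrite !sqr_enorm.
(* [B] is the first-order change of the objective from [p] towards [u], with [r] replaced by its
   chord; the claim amounts to [0 <= B]. *)
set B := r u - r p + dot (u - p) g + 2 * c * dot (p - a) (u - p).
set Q := dot (u - p) (u - p).
have Q0 : 0 <= Q by exact: dot_ge0.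
have cQ0 : 0 <= c * Q by rewrite mulr_ge0.
have key l : 0 < l -> l <= 1 -> 0 <= B + c * l * Q.
  move=> l0 l1.
  have l0' := ltW l0.
  have yin : X (l *: u + (1 - l) *: p).
    have := cX u p (Itv01 l0' l1); rewrite !inE; exact.
  have ry : r (l *: u + (1 - l) *: p) <= l * r u + (1 - l) * r p.
    by apply: (cr (Itv01 l0' l1)); rewrite inE.
  have := pmin _ yin; rewrite !sqr_enorm => hmin.
  rewrite -(pmulr_rge0 _ l0) /B /Q; move: hmin ry.
  rewrite !dotE (dotC a u) (dotC a p) (dotC u p); nra.
suff : 0 <= B.
  rewrite /B /Q !dotE (dotC a u) (dotC a p) (dotC u p); nra.
rewrite leNgt; apply/negP => B0.
have d0 : 0 < c * Q - B by lra.
(* An explicit [l] replaces the limit: it lies in (0, 1] when [B < 0], and turns [B + c * l * Q]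
   into -B^2 / (c Q - B) < 0. *)
have := key (- B / (c * Q - B)).
rewrite divr_gt0 ?oppr_gt0// ler_pdivrMr// mul1r => /(_ isT).
have -> : - B <= c * Q - B by lra.
move=> /(_ isT); rewrite -(pmulr_rge0 _ d0).
have -> : (c * Q - B) * (B + c * (- B / (c * Q - B)) * Q) = - B ^+ 2.
  by field; rewrite gt_eqF.
by rewrite oppr_ge0 leNgt; rewrite exprn_even_gt0//= lt_eqF.
Qed.

(** The subgradient of [r] at [a] moves [r] from [p] back to [a], so [gf] and [gr] both pair with
    [a - p] and a bound on their sum suffices. The |a - p|^2 from Young's inequality cancels against
    the proximal term. *)
Lemma prox_step (X : set 'rV[K]_n) (f r : 'rV[K]_n -> K) (e G : K)
    (gf gr a p u : 'rV[K]_n) :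
  convex_set X -> convex_function X r -> 0 < e -> X u ->
  subdifferential X f a gf -> subdifferential X r a gr -> enorm (gf + gr) <= G ->
  argmin X (fun y => r y + dot y gf + (2 * e)^-1 * enorm (y - a) ^+ 2) p ->
  (f a + r a) - (f u + r u) <=
    e / 2 * G ^+ 2 + (2 * e)^-1 * (enorm (u - a) ^+ 2 - enorm (u - p) ^+ 2).
Proof.
move=> cX cr e0 Xu /(_ _ Xu) fu sr gG amin.
have /sr rp : X p by case: amin.
have c0 : 0 <= (2 * e)^-1 by rewrite invr_ge0 mulr_ge0// ltW.
have h := argmin_prox cX cr c0 amin Xu.
have := dot_le_prox (a - p) e0 gG.
have -> : enorm (a - p) = enorm (p - a) by rewrite -enormN opprB.
move: fu rp h; rewrite !dotE (dotC u gf) (dotC p gf); lra.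
Qed.

(** Serves the last round, which has no next iterate. *)
Lemma subgradient_step (X : set 'rV[K]_n) (f r : 'rV[K]_n -> K) (e G : K)
    (gf gr a u : 'rV[K]_n) :
  0 < e -> X u ->
  subdifferential X f a gf -> subdifferential X r a gr -> enorm (gf + gr) <= G ->
  (f a + r a) - (f u + r u) <= e / 2 * G ^+ 2 + (2 * e)^-1 * enorm (u - a) ^+ 2.
Proof.
move=> e0 Xu /(_ _ Xu) fu /(_ _ Xu) ru gG.
have := dot_le_prox (a - u) e0 gG.
have -> : enorm (a - u) = enorm (u - a) by rewrite -enormN opprB.
move: fu ru; rewrite !dotE; lra.
Qed.

End euclidean.

(** * Weighted telescoping and sums of powers *)

Lemma telescope_weighted (K : realType) (T : nat) (w A B d : nat -> K) (S : K) :
  (forall t, (1 <= t <= T)%N -> 0 <= w t) ->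
  (forall t, (1 <= t < T)%N -> w t <= w t.+1) ->
  (forall t, (1 <= t <= T)%N -> A t <= S) ->
  (forall t, (1 <= t <= T)%N -> 0 <= B t) ->
  (forall t, (1 <= t < T)%N -> 0 <= d t.+1) ->
  (forall t, (1 <= t < T)%N -> A t.+1 <= B t + d t.+1) ->
  (1 <= T)%N ->
  \sum_(1 <= t < T.+1) w t * (A t - B t) <= w T * S + \sum_(2 <= t < T.+1) w t * d t.
Proof.
move=> w0 wS AS B0 d0 AB T1.
(* The invariant keeps the leftover [w B] term, which pays for the next [A]; at the end it is
   nonnegative and dropped. *)
suff H k : (k < T)%N -> \sum_(1 <= t < k.+2) w t * (A t - B t) + w k.+1 * B k.+1
    <= w k.+1 * S + \sum_(2 <= t < k.+2) w t * d t.
  case: T T1 w0 wS AS B0 d0 AB H => // T _ w0 _ _ B0 _ _ /(_ T (ltnSn T)).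
  by apply: le_trans; rewrite lerDl mulr_ge0 ?w0 ?B0 ?ltnSn.
elim: k => [|k IH] kT.
  rewrite big_nat1 big_geq// addr0 -mulrDr subrK ler_wpM2l ?w0 ?AS//.
rewrite big_nat_recr//= [X in _ <= _ + X]big_nat_recr//=.
have := IH (ltnW kT).
have h1 : (1 <= k.+1 < T)%N by [].
have h2 : (1 <= k.+2 <= T)%N by [].
have := w0 _ (ltnW kT : (1 <= k.+1 <= T)%N); have := wS _ h1.
have := AS _ h2; have := d0 _ h1; have := AB _ h1.
(* Abel summation: the new weight is the old one plus an increment. The old weight uses
   [A <= B + d], the increment uses [A <= S]. *)
set s1 := bigop _ _ _; set s2 := bigop _ _ _; nra.
Qed.

(** Stands in for the integral comparison of t^(-g). With y = k + 1, weighted AM-GM gives k^(1-g)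
    y^g <= (1-g) k + g y = y - (1-g); multiply by y^(-g). *)
Lemma powR_step (K : realType) (g : K) (k : nat) : 0 <= g < 1 ->
  k%:R `^ (1 - g) + (1 - g) * k.+1%:R `^ (- g) <= k.+1%:R `^ (1 - g).
Proof.
move=> /andP[g0 g1].
have g1' : 0 < 1 - g by lra.
case: k => [|k]; first by rewrite powR0 ?gt_eqF// !powR1; lra.
set x := k.+1%:R; set y := k.+2%:R.
have x0 : 0 < x :> K by rewrite ltr0n.
have y0 : 0 < y :> K by rewrite ltr0n.
have yx : y = x + 1 by rewrite /y -natr1.
have h0 : 0 <= 1 - g by lra.
have h1 : 1 - g <= 1 by lra.
(* Convexity of exp at [ln x] and [ln y], hence the separate case [k = 0]. *)
have : x `^ (1 - g) * y `^ (1 - (1 - g)) <= (1 - g) * x + (1 - (1 - g)) * y.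
  rewrite /powR !gt_eqF// -expRD -{2}[x]lnK ?posrE// -{2}[y]lnK ?posrE//.
  exact: (convex_expR (Itv01 h0 h1) (ln x) (ln y)).
rewrite subKr.
have yg : y `^ g * y `^ (- g) = 1 by rewrite -powRD ?subrr ?powRr0 ?(gt_eqF y0) ?implybT.
have -> : y `^ (1 - g) = y * y `^ (- g).
  by rewrite powRD ?powRr1 ?(gt_eqF y0) ?implybT// ltW.
move=> /(ler_wpM2r (powR_ge0 y (- g))).
rewrite -mulrA yg yx; lra.
Qed.

Lemma sum_powR_le (K : realType) (g : K) (T : nat) : 0 <= g < 1 ->
  \sum_(1 <= t < T.+1) t%:R `^ (- g) <= T%:R `^ (1 - g) / (1 - g).
Proof.
move=> hg; have g1 : 0 < 1 - g by lra.
elim: T => [|T IH]; first by rewrite big_geq// divr_ge0 ?powR_ge0// ltW.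
rewrite big_nat_recr//=.
have := powR_step T hg.
move: IH; rewrite !ler_pdivlMr//; set s := bigop _ _ _; lra.
Qed.

(** * The step-size constant and the regret bound *)

Lemma path_variation_ge0 (K : realType) (n T : nat) (beta : K) (u : nat -> 'rV[K]_n) :
  0 <= path_variation beta T u.
Proof. by apply: sumr_ge0 => t _; rewrite mulr_ge0 ?powR_ge0 ?enorm_ge0. Qed.

(** Pulling out T^(gamma-1) leaves a radicand of the order of the target rate; the power itself
    cancels in the regret bound. *)
Lemma OPG_sigmaE (K : realType) (R M beta gamma : K) (T : nat) (D : K) :
  (1 <= T)%N ->
  OPG_sigma R M beta gamma T D = T%:R `^ (gamma - 1) / M
    * Num.sqrt (2 * R * (1 - gamma) * (T%:R `^ (1 - beta) * D) + R ^+ 2 * T%:R).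
Proof.
move=> T1; have T0 : T%:R != 0 :> K by rewrite pnatr_eq0 -lt0n.
have E : T%:R `^ (2 * gamma - 1) = (T%:R `^ (gamma - 1)) ^+ 2 * T%:R :> K.
  by rewrite -[X in _ = _ * X]powRr1 ?ler0n// expr2 -!powRD ?T0 ?implybT//; congr (_ `^ _); ring.
have E' : T%:R `^ (2 * gamma - beta - 1)
    = (T%:R `^ (gamma - 1)) ^+ 2 * T%:R `^ (1 - beta) :> K.
  by rewrite expr2 -!powRD ?T0 ?implybT//; congr (_ `^ _); ring.
have -> : T%:R `^ (gamma - 1) = Num.sqrt ((T%:R `^ (gamma - 1)) ^+ 2) :> K.
  by rewrite sqrtr_sqr ger0_norm// powR_ge0.
rewrite /OPG_sigma E E' [RHS]mulrAC -sqrtrM ?sqr_ge0//.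
congr (Num.sqrt _ / M); ring.
Qed.

(** Stated for any positive [sigma], so that the balancing choice comes after the three terms are
    explicit. *)
Lemma OPG_regret_le (K : realType) (R M beta gamma sigma : K) (T n : nat)
    (X : set 'rV[K]_n) (f r : nat -> 'rV[K]_n -> K)
    (gf gr : nat -> 'rV[K]_n -> 'rV[K]_n) (u x : nat -> 'rV[K]_n) :
  0 <= gamma < 1 -> beta <= gamma -> 0 < sigma -> 0 <= R -> (1 <= T)%N ->
  convex_set X ->
  (forall y z, X y -> X z -> enorm (y - z) <= R) ->
  (forall t, (1 <= t <= T)%N -> convex_function X (r t)) ->
  (forall t y, (1 <= t <= T)%N -> X y ->
    subdifferential X (f t) y (gf t y) /\
    subdifferential X (r t) y (gr t y) /\
    enorm (gf t y + gr t y) <= M) ->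
  (forall t, (1 <= t <= T)%N -> X (u t)) ->
  OPG_iterates T X r gf (fun t => t%:R `^ (- gamma) * sigma) x ->
  dynamic_regret T (fun t y => f t y + r t y) x u <=
    M ^+ 2 / 2 * sigma * (T%:R `^ (1 - gamma) / (1 - gamma))
    + (R ^+ 2 / 2 * T%:R `^ gamma
       + R * T%:R `^ (gamma - beta) * path_variation beta T u) / sigma.
Proof.
move=> hg bg s0 R0 T1 cX XR cr hsub Xu [Xx1 xopt].
have Xx t : (1 <= t <= T)%N -> X (x t).
  case: t => // -[|t] // tT; by have [] := xopt t.+1 tT.
pose eta t : K := t%:R `^ (- gamma) * sigma.
have t0 t : (1 <= t)%N -> 0 < t%:R :> K by rewrite ltr0n.
have eta0 t : (1 <= t)%N -> 0 < eta t by move=> ?; rewrite mulr_gt0 ?powR_gt0 ?t0.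
pose w t := (2 * eta t)^-1.
have wE t : w t = t%:R `^ gamma / sigma / 2.
  by rewrite /w /eta powRN !invfM invrK; ring.
pose A t := enorm (u t - x t) ^+ 2.
(* There is no iterate x_(T+1), so its term is replaced by 0. *)
pose B t := if (t < T)%N then enorm (u t - x t.+1) ^+ 2 else 0.
pose d t := 2 * R * enorm (u t - u t.-1).
have step t : (1 <= t <= T)%N ->
    f t (x t) + r t (x t) - (f t (u t) + r t (u t)) <=
    eta t / 2 * M ^+ 2 + w t * (A t - B t).
  move=> tT; have [t1 _] := andP tT.
  have [sf [sr sM]] := hsub t (x t) tT (Xx _ tT).
  (* Rounds [t < T] use the minimizer property; round [T] has only the subgradient inequalities,
     matching [B T = 0]. *)
  rewrite /B; case: ifPn => tT'.
    apply: (prox_step cX (cr _ tT) (eta0 _ t1) (Xu _ tT) sf sr sM).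
    by apply: xopt; rewrite t1.
  rewrite subr0.
  exact: (subgradient_step (eta0 _ t1) (Xu _ tT) sf sr sM).
have tel : \sum_(1 <= t < T.+1) w t * (A t - B t)
    <= w T * R ^+ 2 + \sum_(2 <= t < T.+1) w t * d t.
  have sqR y z : X y -> X z -> enorm (y - z) ^+ 2 <= R ^+ 2.
    by move=> Xy Xz; rewrite ler_sqr ?nnegrE ?enorm_ge0 ?XR.
  have ltT t : (1 <= t < T)%N -> (1 <= t <= T)%N /\ (1 <= t.+1 <= T)%N.
    by move=> /andP[t1 tT]; rewrite t1 tT ltnW.
  apply: telescope_weighted => // t tT.
  - by rewrite wE !divr_ge0 ?powR_ge0// ltW.
  - rewrite !wE ler_pM2r// ler_pM2r ?invr_gt0// ge0_ler_powR ?nnegrE ?ler0n ?ler_nat//.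
    by case/andP: hg.
  - by apply: sqR; [exact: Xu|exact: Xx].
  - by rewrite /B; case: ifP => // _; rewrite sqr_ge0.
  - by rewrite !mulr_ge0 ?enorm_ge0.
  - have [h h'] := ltT _ tT; rewrite /A /B /d; case/andP: tT => _ ->.
    by apply: sqr_enormB_le; apply: XR; do ?[exact: Xu | exact: Xx].
have path : \sum_(2 <= t < T.+1) w t * d t
    <= R * T%:R `^ (gamma - beta) * path_variation beta T u / sigma.
  rewrite /path_variation mulr_sumr mulr_suml ler_sum_nat// => t /andP[t2 tT].
  have t1 := ltnW t2.
  have -> : w t * d t = R * t%:R `^ gamma * enorm (u t - u t.-1) / sigma.
    by rewrite wE /d; field; rewrite gt_eqF.
  have -> : t%:R `^ gamma = t%:R `^ (gamma - beta) * t%:R `^ beta :> K.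
    by rewrite -powRD ?subrK// (gt_eqF (t0 _ t1)) implybT.
  rewrite ler_pM2r ?invr_gt0// -!mulrA ler_wpM2l// ler_wpM2r//.
    by rewrite mulr_ge0 ?powR_ge0 ?enorm_ge0.
  by rewrite ge0_ler_powR ?nnegrE ?ler0n ?ler_nat ?subr_ge0.
have sumeta : \sum_(1 <= t < T.+1) eta t / 2 * M ^+ 2
    <= M ^+ 2 / 2 * sigma * (T%:R `^ (1 - gamma) / (1 - gamma)).
  apply: (@le_trans _ _ (M ^+ 2 / 2 * sigma * \sum_(1 <= t < T.+1) t%:R `^ (- gamma))).
    by rewrite mulr_sumr ler_sum_nat// => t _; rewrite /eta le_eqVlt; apply/orP; left; apply/eqP; ring.
  by rewrite ler_wpM2l ?sum_powR_le// mulr_ge0 ?divr_ge0 ?sqr_ge0// ltW.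
rewrite /dynamic_regret -sumrB.
apply: (@le_trans _ _ (\sum_(1 <= t < T.+1) (eta t / 2 * M ^+ 2 + w t * (A t - B t)))).
  by rewrite ler_sum_nat.
rewrite big_split/= mulrDl lerD// (le_trans tel)// lerD//.
by rewrite wE le_eqVlt; apply/orP; left; apply/eqP; ring.
Qed.

(** [C] is chosen before the horizon, the dimension, the functions and the sequences, which is the
    uniformity that the O-notation asks for. *)
Theorem theorem1 (K : realType) (R M beta gamma : K)
  (hR : 0 < R) (hM : 0 < M)
  (hbeta : 0 <= beta < 1) (hgamma : beta <= gamma < 1) :
  exists C : K, 0 < C /\
    forall (T n : nat) (X : set 'rV[K]_n)
      (f r : nat -> 'rV[K]_n -> K)
      (gf gr : nat -> 'rV[K]_n -> 'rV[K]_n)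
      (u x : nat -> 'rV[K]_n),
      (1 <= T)%N ->
      X !=set0 -> convex_set X -> compact X ->
      (forall y z, X y -> X z -> enorm (y - z) <= R) ->
      (forall t, (1 <= t <= T)%N ->
        closed_convex_function X (f t) /\ closed_convex_function X (r t)) ->
      (forall t y, (1 <= t <= T)%N -> X y ->
        subdifferential X (f t) y (gf t y) /\
        subdifferential X (r t) y (gr t y) /\
        enorm (gf t y + gr t y) <= M) ->
      (forall t, (1 <= t <= T)%N -> X (u t)) ->
      OPG_iterates T X r gf
        (fun t => t%:R `^ (- gamma)
                  * OPG_sigma R M beta gamma T (path_variation beta T u)) x ->
      dynamic_regret T (fun t y => f t y + r t y) x u
        <= C * Num.sqrt (T%:R `^ (1 - beta) * path_variation beta T u + T%:R).
Proof.
have g1 : 0 < 1 - gamma by case/andP: hgamma; lra.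
have [bg _] := andP hgamma.
have hg : 0 <= gamma < 1 by case/andP: hgamma; case/andP: hbeta; lra.
have RR0 : 0 < 2 * R + R ^+ 2 by rewrite addr_gt0 ?mulr_gt0 ?exprn_gt0.
(* The first factor comes from balancing the terms, the root from P <= (2R + R^2)(E + T) below. *)
exists (M / (1 - gamma) * Num.sqrt (2 * R + R ^+ 2)); split.
  by rewrite mulr_gt0 ?divr_gt0 ?sqrtr_gt0.
move=> T n X f r gf gr u x T1 _ cX _ XR cfr hsub Xu.
set D := path_variation beta T u.
have D0 : 0 <= D by exact: path_variation_ge0.
have T0 : 0 < T%:R :> K by rewrite ltr0n.
have Tn0 : T%:R != 0 :> K by rewrite gt_eqF.
set E := T%:R `^ (1 - beta) * D.
have E0 : 0 <= E by rewrite mulr_ge0 ?powR_ge0.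
rewrite OPG_sigmaE// -/E.
set P := 2 * R * (1 - gamma) * E + R ^+ 2 * T%:R.
(* The term R^2 T keeps [sigma] positive even for constant comparators. *)
have P0 : 0 < P.
  by rewrite ltr_wpDl ?mulr_gt0 ?exprn_gt0// !mulr_ge0// ltW.
have q0 : 0 < Num.sqrt P by rewrite sqrtr_gt0.
have q2 : Num.sqrt P ^+ 2 = P by rewrite sqr_sqrtr// ltW.
set q := Num.sqrt P in q0 q2 *.
set a := T%:R `^ (gamma - 1).
have a0 : 0 < a by rewrite powR_gt0.
have s0 : 0 < a / M * q by rewrite mulr_gt0// divr_gt0.
move=> xopt.
have cr t : (1 <= t <= T)%N -> convex_function X (r t).
  by move=> /cfr[_ []].
apply: (le_trans (OPG_regret_le hg bg s0 (ltW hR) T1 cX XR cr hsub Xu xopt)).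
rewrite -/D.
have e1 : T%:R `^ (1 - gamma) = a^-1 by rewrite /a -powRN opprB.
have e2 : T%:R `^ gamma = a * T%:R.
  by rewrite /a -[X in _ = _ * X]powRr1 ?ler0n// -powRD ?Tn0 ?implybT// subrK.
have e3 : R * T%:R `^ (gamma - beta) * D = R * (a * E).
  rewrite /a /E -mulrA; congr (R * _); rewrite mulrA -powRD ?Tn0 ?implybT//.
  by congr (_ `^ _ * _); ring.
rewrite {}e1 {}e2 {}e3.
apply: (@le_trans _ _ (M / (1 - gamma) * q)).
  (* All powers [a] cancel. The numerator over [q] is at most P = q^2 because 1 - gamma <= 1, so the
     bracket is at most 2 q. *)
  have -> : M ^+ 2 / 2 * (a / M * q) * (a^-1 / (1 - gamma)) +
      (R ^+ 2 / 2 * (a * T%:R) + R * (a * E)) / (a / M * q)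
      = M / (2 * (1 - gamma)) * (q + ((1 - gamma) * R ^+ 2 * T%:R + 2 * R * (1 - gamma) * E) / q).
    by field; rewrite !gt_eqF.
  have -> : M / (1 - gamma) * q = M / (2 * (1 - gamma)) * (q + q).
    by field; rewrite gt_eqF.
  rewrite ler_pM2l ?divr_gt0 ?mulr_gt0// lerD2l ler_pdivrMr// -expr2 q2 /P addrC lerD2l.
  rewrite -mulrA ler_piMl//; last by case/andP: hg; lra.
  by rewrite mulr_ge0 ?sqr_ge0// ltW.
rewrite -[leRHS]mulrA ler_pM2l ?divr_gt0// -sqrtrM ?(ltW RR0)//.
apply: ler_wsqrtr; rewrite /P.
(* The slack (2R + R^2)(E + T) - P equals 2 gamma R E + 2 R T + R^2 E. *)
have h1 : 0 <= gamma * (R * E) by case/andP: hg => g0 _; rewrite !mulr_ge0// ltW.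
have h2 : 0 <= R * T%:R by rewrite mulr_ge0 ?ltW.
have h3 : 0 <= R ^+ 2 * E by rewrite mulr_ge0 ?sqr_ge0.
lra.
Qed.
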